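(* Let $|\psi_1\rangle$ and $|\psi_2\rangle$ be two entangled bipartite pure states. Then $$0<D(|\psi_1\rangle,|\psi_2\rangle)\leq R(|\psi_1\rangle,|\psi_2\rangle),$$ where $D$ is the deterministic entanglement exchange rate and $R$ is the entropy ratio.
   Context: All states are bipartite pure states on finite-dimensional spaces. Such a state has a Schmidt decomposition $|\psi\rangle=\sum_{i=1}^n\sqrt{\alpha_i}\,|i\rangle|i\rangle$ with $\alpha_1\ge\dots\ge\alpha_n\ge 0$, $\sum_i\alpha_i=1$; the numbers $\alpha_i$ (without square root) are called its Schmidt coefficients, and $\lambda_\psi=(\alpha_1,\dots,\alpha_n)$ is its ordered Schmidt coefficient vector. The state is entangled if at least two Schmidt coefficients are nonzero (equivalently $\alpha_1<1$). For a tensor product of bipartite states, each party holds the corresponding halves of all factors, so the Schmidt coefficients of $|\psi\rangle\otimes|\phi\rangle$ are all products of a Schmidt coefficient of $|\psi\rangle$ with one of $|\phi\rangle$. Write $|\psi_1\rangle\rightarrow|\psi_2\rangle$ if $|\psi_1\rangle$ can be transformed into $|\psi_2\rangle$ with certainty by local operations and classical communication (LOCC). By Nielsen's theorem (known, may be used as the definition), this holds if and only if $\lambda_{\psi_1}\prec\lambda_{\psi_2}$, i.e. for every $l$ the sum of the $l$ largest components of $\lambda_{\psi_1}$ is at most that of $\lambda_{\psi_2}$ (vectors being padded with zeros to a common length). For entangled states $|\psi_1\rangle,|\psi_2\rangle$ and a positive integer $m$, let $f(m)=\max\{n\geq 1: |\psi_1\rangle^{\otimes m}\rightarrow|\psi_2\rangle^{\otimes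 n}\}$, with $f(m)=0$ if this set is empty. The deterministic entanglement exchange rate is $D(|\psi_1\rangle,|\psi_2\rangle)=\sup_{m\ge1}\frac{f(m)}{m}$. For $\tau>0$, $\tau\ne1$, the $\tau$-order Renyi entropy is $S^{(\tau)}(|\psi\rangle)=\frac{1}{1-\tau}\log_2\sum_{i}\alpha_i^\tau$; moreover $S^{(0)}(|\psi\rangle)=\log_2 d$ with $d$ the number of nonzero Schmidt coefficients, $S^{(1)}(|\psi\rangle)=-\sum_i\alpha_i\log_2\alpha_i$, and $S^{(+\infty)}(|\psi\rangle)=-\log_2\alpha_1$. The entropy ratio of entangled states is $R(|\psi_1\rangle,|\psi_2\rangle)=\inf_{\tau\ge0}\frac{S^{(\tau)}(|\psi_1\rangle)}{S^{(\tau)}(|\psi_2\rangle)}$. *)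

(* Defs.v *)
From mathcomp Require Import all_boot all_order all_algebra.
From mathcomp Require Import complex mxtens.
From mathcomp Require Import boolp classical_sets reals ereal exp.

Set Implicit Arguments.
Unset Strict Implicit.
Unset Printing Implicit Defensive.

Import Order.TTheory GRing.Theory Num.Theory.

Local Open Scope classical_set_scope.
Local Open Scope complex_scope.
Local Open Scope ring_scope.

(* A vector of C^a (x) C^b is represented by its amplitude matrix
   psi : 'M[R[i]]_(a, b): psi i j is its coefficient on |i>|j>.  The tensor
   product of two bipartite vectors, each party holding the corresponding
   halves, is then the Kronecker product psi *t phi, and the m-fold tensor
   power is psi ^t m. *)
Section BipartiteStates.
Variable R : realType.

Definition pure_state (a b : nat) (psi : 'M[R[i]]_(a, b)) : Prop :=
  \sum_i \sum_j `|psi i j| ^+ 2 = 1.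

(* psi = sum_k sqrt(s_k) |u_k>|v_k> with s nonincreasing and nonnegative, the
   |u_k> and the |v_k> being the (orthonormal) rows of U and V. *)
Definition schmidt_decomposition (a b : nat) (psi : 'M[R[i]]_(a, b))
    (s : seq R) : Prop :=
  [/\ size s = minn a b, sorted >=%R s, all (>= 0) s &
      exists (U : 'M[R[i]]_(minn a b, a)) (V : 'M[R[i]]_(minn a b, b)),
        [/\ U \is unitarymx, V \is unitarymx &
            psi = \sum_(k < minn a b)
                    (Num.sqrt s`_k)%:C *: ((row k U)^T *m row k V)]].

(* The ordered Schmidt coefficient vector: every psi has exactly one such s,
   so the default value of xget is never used. *)
Definition schmidt_vector (a b : nat) (psi : 'M[R[i]]_(a, b)) : seq R :=
  xget [::] [set s | schmidt_decomposition psi s].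

Definition schmidt_rank (a b : nat) (psi : 'M[R[i]]_(a, b)) : nat :=
  count (fun x => x != 0) (schmidt_vector psi).

Definition entangled (a b : nat) (psi : 'M[R[i]]_(a, b)) : Prop :=
  (2 <= schmidt_rank psi)%N.

(* Vectors are compared after padding with zeros, the default value of s`_i;
   since Schmidt vectors are nonincreasing, their first l entries are the l
   largest ones. *)
Definition majorized (s t : seq R) : Prop :=
  forall l : nat, \sum_(i < l) s`_i <= \sum_(i < l) t`_i.

(* Deterministic LOCC convertibility, through Nielsen's theorem. *)
Definition locc (a b c d : nat) (psi : 'M[R[i]]_(a, b))
    (phi : 'M[R[i]]_(c, d)) : Prop :=
  majorized (schmidt_vector psi) (schmidt_vector phi).

(* The largest n >= 1 such that psi1^(x)m --> psi2^(x)n, and 0 if there is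
   none.  For psi2 entangled the set of such n is bounded: LOCC does not
   increase the Schmidt rank, hence
   schmidt_rank psi2 ^ n <= schmidt_rank psi1 ^ m. *)
Definition max_copies (a1 b1 a2 b2 : nat) (psi1 : 'M[R[i]]_(a1, b1))
    (psi2 : 'M[R[i]]_(a2, b2)) (m : nat) : nat :=
  xget 0%N [set n | [/\ (1 <= n)%N, locc (psi1 ^t m) (psi2 ^t n) &
    forall k, (1 <= k)%N -> locc (psi1 ^t m) (psi2 ^t k) -> (k <= n)%N]].

Definition exchange_rate (a1 b1 a2 b2 : nat) (psi1 : 'M[R[i]]_(a1, b1))
    (psi2 : 'M[R[i]]_(a2, b2)) : \bar R :=
  ereal_sup [set ((max_copies psi1 psi2 m)%:R / m%:R)%:E
            | m in [set m | (1 <= m)%N]].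

Definition log2 (x : R) : R := ln x / ln 2.

(* The order ranges over [0, +oo]; the value at -oo is irrelevant.  In the
   sums, zero coefficients contribute 0 since 0 `^ t = 0 for t != 0. *)
Definition renyi_entropy (tau : \bar R) (a b : nat) (psi : 'M[R[i]]_(a, b)) :
    R :=
  match tau with
  | t%:E =>
      if t == 0 then log2 (schmidt_rank psi)%:R
      else if t == 1 then - \sum_(x <- schmidt_vector psi) x * log2 x
      else (1 - t)^-1 * log2 (\sum_(x <- schmidt_vector psi) x `^ t)
  | +oo%E => - log2 (schmidt_vector psi)`_0
  | -oo%E => 0
  end.

Definition entropy_ratio (a1 b1 a2 b2 : nat) (psi1 : 'M[R[i]]_(a1, b1))
    (psi2 : 'M[R[i]]_(a2, b2)) : \bar R :=
  ereal_inf [set (renyi_entropy tau psi1 / renyi_entropy tau psi2)%:E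
            | tau in [set tau : \bar R | (0 <= tau)%E]].

End BipartiteStates.

(* Main.v *)
Require Import Defs.
From mathcomp Require Import all_boot all_order all_algebra.
From mathcomp Require Import perm.
From mathcomp Require Import complex mxtens.
From mathcomp Require Import lra ring.
From mathcomp Require Import boolp classical_sets reals ereal exp.

(* Schmidt vectors are determined by the power sums tr((psi psi^H)^n) =
   sum_i alpha_i^n; hence they are unique and, up to reordering, the vector of
   a tensor power consists of the products of coefficients.

   Positivity: the largest coefficient of psi1^(x)m is alpha_1^m, which tends
   to 0, so for large m every partial sum of fewer than d terms (d the length
   of the vector of psi2) is at most beta_1; thus psi1^(x)m --> psi2.

   Upper bound: if psi1^(x)m --> psi2^(x)n, Karamata's inequality applied to
   -[x != 0], -x^tau, x ln x, x^tau gives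
   n S(psi2) = S(psi2^(x)n) <= S(psi1^(x)m) = m S(psi1) for each Renyi
   entropy S, and these are positive on entangled states. *)

Set Implicit Arguments.
Unset Strict Implicit.

Import Order.TTheory GRing.Theory Num.Theory.

Local Open Scope ring_scope.

(** * Recovering a list from its power sums *)

Section PowerSums.
Variable F : numFieldType.
Implicit Types s t : seq F.

(** Linearity in [p]; the factor [x] is there because only power sums of positive exponent are
    given. *)
Lemma sum_horner_pow s t :
    (forall k, \sum_(x <- s) x ^+ k.+1 = \sum_(x <- t) x ^+ k.+1) ->
  forall p : {poly F}, \sum_(x <- s) x * p.[x] = \sum_(x <- t) x * p.[x].
Proof.
move=> st p.
have E (u : seq F) : \sum_(x <- u) x * p.[x] =
    \sum_(i < size p) p`_i * \sum_(x <- u) x ^+ i.+1.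
  under eq_bigr do rewrite horner_coef mulr_sumr.
  rewrite exchange_big; apply: eq_bigr => i _ /=.
  by rewrite mulr_sumr; apply: eq_bigr => x _; rewrite mulrCA exprS.
by rewrite !E; apply: eq_bigr => i _; rewrite st.
Qed.

Lemma perm_eq_power_sums s t : size s = size t ->
    (forall k, \sum_(x <- s) x ^+ k.+1 = \sum_(x <- t) x ^+ k.+1) ->
  perm_eq s t.
Proof.
move=> sz /sum_horner_pow st.
have nz x : x != 0 -> count_mem x s = count_mem x t.
  move=> x0.
  (* Testing against a polynomial that vanishes on all entries but x isolates
     the multiplicity of x, except for x = 0. *)
  pose p := \prod_(y <- undup (s ++ t) | y != x) ('X - y%:P).
  have px : p.[x] != 0.
    rewrite horner_prod prodf_seq_neq0; apply/allP => y _; apply/implyP => yx.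
    by rewrite hornerXsubC subr_eq0 eq_sym.
  have E (u : seq F) : {subset u <= s ++ t} ->
      \sum_(y <- u) y * p.[y] = (count_mem x u)%:R * (x * p.[x]).
    move=> us; rewrite -sum1_count natr_sum mulr_suml.
    rewrite (bigID (pred1 x)) /= [X in _ + X]big1_seq.
      by rewrite addr0; apply: eq_bigr => y /eqP ->; rewrite mul1r.
    move=> y /andP[yx yu]; suff -> : p.[y] = 0 by rewrite mulr0.
    apply/eqP; rewrite horner_prod prodf_seq_eq0; apply/hasP; exists y.
      by rewrite mem_undup us.
    by rewrite yx hornerXsubC subrr eqxx.
  have := st p; rewrite !E; [|by move=> y yt; rewrite mem_cat yt ?orbT..].
  move/mulIf; rewrite mulf_neq0 // => /(_ isT)/eqP.
  by rewrite eqr_nat => /eqP.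
(* The power sums do not see zeros: the multiplicity of 0 is the common size minus the number of
   nonzero entries. *)
apply/allP => x _ /=; apply/eqP; have [->|/nz//] := eqVneq x 0.
have C (u : seq F) : size u = (count_mem 0%R u + count (fun x => x != 0%R) u)%N.
  by rewrite -(count_predC (pred1 0%R) u).
have E : count (fun x => x != 0%R) s = count (fun x => x != 0%R) t.
  rewrite -!size_filter; apply/perm_size/allP => y _ /=; apply/eqP.
  rewrite !count_filter; have [->|y0] := eqVneq y 0.
    by rewrite !(@eq_count _ _ pred0) ?count_pred0 // => z /=; case: eqP.
  have G (u : seq F) : count (predI (pred1 y) (fun x => x != 0%R)) u =
      count_mem y u.
    by apply: eq_count => z /=; case: eqVneq => [->|].
  by rewrite !G nz.
by move: sz; rewrite (C s) (C t) E => /addIn.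
Qed.

End PowerSums.

(** * Schmidt decompositions: traces, uniqueness, sorting, tensor products *)

Section SchmidtForm.
Local Open Scope complex_scope.
Local Open Scope sesquilinear_scope.
Variable R : realType.
Implicit Types (k l a b m : nat) (s : seq R).

(** Leaving the order and the number of coefficients free makes this form stable under tensor
    products. *)
Definition schmidt_form k a b (psi : 'M[R[i]]_(a, b)) (d : 'I_k -> R) :=
  exists (U : 'M[R[i]]_(k, a)) (V : 'M[R[i]]_(k, b)),
    [/\ U \is unitarymx, V \is unitarymx &
        psi = U^T *m diag_mx (\row_j (Num.sqrt (d j))%:C) *m V].

Lemma sum_dyads k a b (U : 'M[R[i]]_(k, a)) (V : 'M[R[i]]_(k, b))
    (d : 'I_k -> R[i]) :
  \sum_j d j *: ((row j U)^T *m row j V) = U^T *m diag_mx (\row_j d j) *m V.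
Proof.
apply/matrixP => i j; rewrite summxE mxE; apply: eq_bigr => n _.
rewrite !mxE big_ord1 !mxE (bigD1 n) //= big1 => [|h hn].
  by rewrite !mxE eqxx mulr1n addr0 mulrA mulrAC mulrC mulrA [U _ _ * _]mulrC.
by rewrite !mxE (negPf hn) mulr0n mulr0.
Qed.

(** Since V V^H = 1, psi psi^H equals U^T D^2 W with W the conjugate of U; then W U^T = 1 collapses
    its powers, and the trace is cyclic. *)
Lemma schmidt_form_tr k a b (psi : 'M[R[i]]_(a, b)) (d : 'I_k -> R) n :
    (forall j, 0 <= d j) -> schmidt_form psi d ->
  \tr (iter n (mulmx (psi *m psi^t*)) (psi *m psi^t*)) =
  (\sum_j d j ^+ n.+1)%:C.
Proof.
move=> d0 [U [V [/unitarymxP UU /unitarymxP VV ->]]].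
set D := diag_mx _; pose W := map_mx Num.conj U.
have WU : W *m U^T = 1%:M.
  by apply: trmx_inj; rewrite trmx_mul trmxK trmx1 map_trmx.
have DD : D^t* = D.
  rewrite tr_diag_mx map_diag_mx; congr diag_mx; apply/rowP => j.
  by rewrite !mxE; exact: conjc_real.
pose E m : 'M[R[i]]_k := diag_mx (\row_j (d j ^+ m)%:C).
have D2 : D *m D = E 1%N.
  rewrite mulmx_diag; congr diag_mx; apply/rowP => j; rewrite !mxE -rmorphM.
  by rewrite -expr2 sqr_sqrtr.
have -> : U^T *m D *m V *m (U^T *m D *m V)^t* = U^T *m E 1%N *m W.
  rewrite !trmx_mul !map_mxM trmxK DD !mulmxA -(mulmxA _ V) VV mulmx1.
  by rewrite -(mulmxA U^T D) D2.
have EE m : E 1%N *m E m = E m.+1.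
  rewrite mulmx_diag; congr diag_mx; apply/rowP => j; rewrite !mxE -rmorphM.
  by rewrite expr1 exprS.
have -> : iter n (mulmx (U^T *m E 1%N *m W)) (U^T *m E 1%N *m W) =
    U^T *m E n.+1 *m W.
  elim: n => //= n ->; rewrite !mulmxA -(mulmxA _ W) WU mulmx1.
  by rewrite -(mulmxA U^T) EE.
rewrite mxtrace_mulC mulmxA WU mul1mx mxtrace_diag rmorph_sum.
by apply: eq_bigr => j _; rewrite mxE.
Qed.

Lemma schmidt_form_nth a b (psi : 'M[R[i]]_(a, b)) s :
    schmidt_decomposition psi s ->
  schmidt_form psi (fun i : 'I_(minn a b) => s`_i).
Proof.
by case=> _ _ _ [U [V [UU VV ->]]]; exists U, V; split=> //; exact: sum_dyads.
Qed.

Lemma schmidt_decomposition_tr a b (psi : 'M[R[i]]_(a, b)) s n :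
    schmidt_decomposition psi s ->
  \tr (iter n (mulmx (psi *m psi^t*)) (psi *m psi^t*)) =
  (\sum_(x <- s) x ^+ n.+1)%:C.
Proof.
move=> sdec; rewrite (schmidt_form_tr n _ (schmidt_form_nth sdec)).
  by case: sdec => ss _ _ _; rewrite (big_nth 0) big_mkord ss.
by case: sdec => ss _ /all_nthP s0 _ j; apply: s0; rewrite ss.
Qed.

Lemma schmidt_decomposition_uniq a b (psi : 'M[R[i]]_(a, b)) s t :
  schmidt_decomposition psi s -> schmidt_decomposition psi t -> s = t.
Proof.
move=> ds dt; case: (ds) (dt) => ss so s0 _ [ts to t0 _].
apply: (sorted_eq ge_trans) so to _; first exact: ge_anti.
apply: perm_eq_power_sums => [|n]; first by rewrite ss ts.
apply: (@complexI R); rewrite -!(schmidt_decomposition_tr _ ds).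
by rewrite -!(schmidt_decomposition_tr _ dt).
Qed.

Lemma schmidt_vectorE a b (psi : 'M[R[i]]_(a, b)) s :
  schmidt_decomposition psi s -> schmidt_vector psi = s.
Proof.
by move=> ds; apply: xget_unique => // t /schmidt_decomposition_uniq; apply.
Qed.

(** Entanglement excludes the default [[::]], whose rank is 0, so a decomposition exists without
    appeal to the singular value decomposition. *)
Lemma schmidt_vectorP a b (psi : 'M[R[i]]_(a, b)) :
  entangled psi -> schmidt_decomposition psi (schmidt_vector psi).
Proof.
rewrite /entangled /schmidt_rank /schmidt_vector; case: xgetP => // t ->.
Qed.

(** This is the first trace identity: tr(psi psi^H) is the squared norm of [psi]. *)
Lemma schmidt_decomposition_sum a b (psi : 'M[R[i]]_(a, b)) s :
  pure_state psi -> schmidt_decomposition psi s -> \sum_(x <- s) x = 1.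
Proof.
move=> psi1 /(schmidt_decomposition_tr 0) /= E; apply: (@complexI R).
rewrite -[RHS]psi1; apply/esym; rewrite [LHS](_ : _ = \tr (psi *m psi^t*)).
  by rewrite E; congr (_ %:C); apply: eq_bigr => x _; rewrite expr1.
apply: eq_bigr => i _; rewrite mxE; apply: eq_bigr => j _.
by rewrite !mxE normCK.
Qed.

Lemma schmidt_form_sort k a b (psi : 'M[R[i]]_(a, b)) (d : 'I_k -> R) :
    minn a b = k -> (forall j, 0 <= d j) -> schmidt_form psi d ->
  schmidt_decomposition psi (sort >=%R (codom d)).
Proof.
move=> kE; rewrite -kE in d * => d0 [U [V [UU VV psiE]]].
set t := sort _ _.
have sz : size t = minn a b by rewrite size_sort size_codom card_ord.
split=> //.
- exact/sort_sorted/ge_total.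
- by rewrite all_sort; apply/allP => x /codomP[j ->].
(* The sorting permutation [p] is applied to the rows of both [U] and [V], which stay
   orthonormal. *)
have /tuple_permP[p tE] : perm_eq t (mktuple d) by rewrite /t perm_sort.
have tp (j : 'I_(minn a b)) : t`_j = d (p j).
  by rewrite tE (nth_map j) ?size_enum_ord // nth_ord_enum tnth_mktuple.
have rp n (W : 'M[R[i]]_(_, n)) j : row j (row_perm p W) = row (p j) W.
  by apply/rowP => h; rewrite !mxE.
exists (row_perm p U), (row_perm p V); split.
- apply/row_unitarymxP => i j; rewrite !rp (row_unitarymxP _) //.
  by rewrite (inj_eq perm_inj).
- apply/row_unitarymxP => i j; rewrite !rp (row_unitarymxP _) //.
  by rewrite (inj_eq perm_inj).
rewrite psiE -sum_dyads (reindex_inj (@perm_inj _ p)).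
by apply: eq_bigr => j _; rewrite tp !rp.
Qed.

(** By the mixed-product rule the three factors tensor separately; the square root is multiplicative
    on nonnegative coefficients. *)
Lemma schmidt_form_tens k a b (psi : 'M[R[i]]_(a, b)) (d : 'I_k -> R)
    l a' b' (phi : 'M[R[i]]_(a', b')) (e : 'I_l -> R) :
    (forall j, 0 <= d j) -> schmidt_form psi d -> schmidt_form phi e ->
  schmidt_form (psi *t phi)
    (fun j => d (mxtens_unindex j).1 * e (mxtens_unindex j).2).
Proof.
move=> d0 [U [V [UU VV ->]]] [U' [V' [UU' VV' ->]]].
have tens_unitary n n' (A : 'M[R[i]]_(k, n)) (B : 'M[R[i]]_(l, n')) :
    A \is unitarymx -> B \is unitarymx -> A *t B \is unitarymx.
  move=> /unitarymxP AA /unitarymxP BB; apply/unitarymxP.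
  rewrite trmx_tens map_mxT tensmx_mul AA BB; apply/matrixP => i j.
  case: (mxtens_indexP i) => i0 i1; case: (mxtens_indexP j) => j0 j1.
  rewrite tensmxE !mxE -natrM mulnb (inj_eq (can_inj (@mxtens_indexK k l))).
  by rewrite xpair_eqE.
exists (U *t U'), (V *t V'); split; [exact: tens_unitary..|].
rewrite -!tensmx_mul -trmx_tens; congr (_ *m _ *m _).
apply/matrixP => i j.
case: (mxtens_indexP i) => i0 i1; case: (mxtens_indexP j) => j0 j1.
rewrite tensmxE !mxE !mxtens_indexK /= sqrtrM // rmorphM.
rewrite (inj_eq (can_inj (@mxtens_indexK k l))) xpair_eqE.
by case: eqP; case: eqP => _ _; rewrite /= ?mulr1n ?mulr0n ?mulr0 ?mul0r.
Qed.

End SchmidtForm.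

(** * Schmidt vectors of tensor powers *)

Section SchmidtPower.
Local Open Scope complex_scope.
Variable R : realType.
Implicit Types (k l a b m : nat) (s t : seq R).

(** Products are kept with multiplicity and unsorted; sorting happens only once the whole power is
    formed. *)
Definition tens_seq s t := [seq x * y | x <- s, y <- t].
Definition tens_pow s m := iter m (tens_seq s) [:: 1].

(** [mxtens_index] is a bijection from pairs of indices, so the two lists enumerate the same
    products. *)
Lemma perm_codom_tens k l (d : 'I_k -> R) (e : 'I_l -> R) :
  perm_eq (codom (fun j => d (mxtens_unindex j).1 * e (mxtens_unindex j).2))
          (tens_seq (codom d) (codom e)).
Proof.
have -> : tens_seq (codom d) (codom e) =
    [seq d (mxtens_unindex j).1 * e (mxtens_unindex j).2
    | j <- [seq mxtens_index (i, j) | i <- enum 'I_k, j <- enum 'I_l]].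
  rewrite map_allpairs /tens_seq /codom /image_mem allpairs_mapl allpairs_mapr.
  by apply: eq_allpairs => // i j; rewrite mxtens_indexK.
apply/perm_map/uniq_perm.
- exact: enum_uniq.
- apply: allpairs_uniq; rewrite ?enum_uniq // => -[i j] [i' j'] _ _ /=.
  exact: (can_inj (@mxtens_indexK k l)).
move=> j; rewrite mem_enum; apply/esym/allpairsP; exists (mxtens_unindex j).
by rewrite !mem_enum -surjective_pairing mxtens_unindexK.
Qed.

Lemma schmidt_form_pow k a b (psi : 'M[R[i]]_(a, b)) (d : 'I_k -> R) m :
    (forall j, 0 <= d j) -> schmidt_form psi d ->
  exists e : 'I_(k ^ m.+1) -> R, [/\ forall j, 0 <= e j,
    perm_eq (codom e) (tens_pow (codom d) m.+1) & schmidt_form (psi ^t m.+1) e].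
Proof.
move=> d0 psid; elim: m => [|m [e [e0 ed psie]]].
  (* The first tensor power is [psi] itself, while [tens_pow] still carries a factor 1 from its
     seed. *)
  exists d; split=> //; rewrite /tens_pow /= /tens_seq.
  by elim: (codom d) => //= x s; rewrite mulr1 perm_cons.
exists (fun j => d (@mxtens_unindex k (k ^ m.+1) j).1 *
                 e (@mxtens_unindex k (k ^ m.+1) j).2); split.
- by move=> j; rewrite mulr_ge0.
- apply: (perm_trans (perm_codom_tens d e)).
  by rewrite /tens_pow iterS perm_allpairs.
- exact: schmidt_form_tens.
Qed.

Lemma schmidt_vector_pow a b (psi : 'M[R[i]]_(a, b)) m :
    entangled psi -> (0 < m)%N ->
  schmidt_vector (psi ^t m) = sort >=%R (tens_pow (schmidt_vector psi) m).
Proof.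
case: m => // m /schmidt_vectorP ds _; apply: schmidt_vectorE.
set s := schmidt_vector psi in ds *; case: (ds) => sz _ /allP s0 _.
have sE : codom (fun i : 'I_(minn a b) => s`_i) = s.
  by rewrite codomE -[RHS](mkseq_nth 0) sz /mkseq -val_enum_ord -map_comp.
have [|e [e0 es psie]] := schmidt_form_pow m _ (schmidt_form_nth ds).
  by move=> j; apply: s0; rewrite mem_nth ?sz.
rewrite sE in es.
have <- : sort >=%R (codom e) = sort >=%R (tens_pow s m.+1).
  by apply/perm_sortP => //; [exact: ge_total|exact: ge_trans|exact: ge_anti].
(* The required length min(a^m, b^m) equals min(a, b)^m, as powers are monotone. *)
apply: schmidt_form_sort => //; rewrite /minn ltn_exp2r //.
by case: ltnP.
Qed.

End SchmidtPower.

(** * Majorization, Karamata's inequality and tangent-line bounds *)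

Section Majorization.
Variable R : realType.
Implicit Types (s t u : seq R) (x y z : R).

Definition prob_vec s :=
  [/\ sorted >=%R s, all (>= 0) s & \sum_(x <- s) x = 1].

(** [n] may be below or above the length of [u]: both sums extend to n + size u by terms equal to g
    0 = 0. *)
Lemma sum_nth (g : R -> R) u n : g 0 = 0 ->
    (forall i, (n <= i)%N -> u`_i = 0) ->
  \sum_(x <- u) g x = \sum_(i < n) g u`_i.
Proof.
move=> g0 un; rewrite (big_nth 0) -(big_mkord xpredT (fun i => g u`_i)).
have E m k : (forall i, (m <= i)%N -> u`_i = 0) ->
    \sum_(0 <= i < m + k) g u`_i = \sum_(0 <= i < m) g u`_i.
  move=> um; rewrite (@big_cat_nat _ _ _ m) ?leq_addr //=.
  rewrite [X in _ + X]big_nat [X in _ + X]big1 ?addr0 //.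
  by move=> i /andP[mi _]; rewrite um.
rewrite -(E n (size u)) // addnC E // => i; exact: nth_default.
Qed.

Lemma nth_ge0 s i : all (>= 0) s -> 0 <= s`_i.
Proof.
move=> /allP s0; case: (ltnP i (size s)) => si; first exact/s0/mem_nth.
by rewrite nth_default.
Qed.

Lemma nth_sorted_le s i j : sorted >=%R s -> all (>= 0) s -> (i <= j)%N ->
  s`_j <= s`_i.
Proof.
move=> so s0 ij; case: (ltnP j (size s)) => sj; last first.
  by rewrite nth_default // nth_ge0.
apply: (sorted_leq_nth ge_trans (@lexx _ R) 0 so) => //.
by rewrite inE (leq_ltn_trans ij).
Qed.

Lemma prob_partial_sum s l : prob_vec s -> \sum_(i < l) s`_i <= 1.
Proof.
case=> so s0 <-; rewrite (sum_nth (g := id) (n := l + size s)) // => [|i].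
  rewrite big_split_ord /= lerDl sumr_ge0 // => i _; exact: nth_ge0.
by move=> si; rewrite nth_default // (leq_trans _ si) // leq_addl.
Qed.

Lemma prob_nth_le1 s i : prob_vec s -> s`_i <= 1.
Proof.
move=> ps; case: (ps) => _ s0 _; apply: le_trans (prob_partial_sum i.+1 ps).
by rewrite big_ord_recr /= lerDr sumr_ge0 // => j _; exact: nth_ge0.
Qed.

Lemma prob_supp s : prob_vec s -> exists2 r, (forall i, (i < r)%N -> 0 < s`_i) &
  forall i, (r <= i)%N -> s`_i = 0.
Proof.
(* The entries decrease, so all vanish from the first zero on; without a zero [find] returns the
   length. *)
case=> so s0 _; exists (find (pred1 0) s) => i.
  by move=> /(before_find 0) /= /negbT si; rewrite lt_neqAle eq_sym si nth_ge0.
move=> ri; apply/eqP; rewrite eq_le nth_ge0 // andbT.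
apply: le_trans (nth_sorted_le so s0 ri) _; case: (boolP (has (pred1 0) s)).
  by move=> /(nth_find 0) /eqP ->.
by move=> /hasNfind ->; rewrite nth_default.
Qed.

(** Abel summation by induction: lowering the weight of a nonnegative partial sum from c_n to
    c_(n+1) can only decrease it. *)
Lemma abel_le (c d : nat -> R) n :
    (forall i, (i < n)%N -> c i.+1 <= c i) ->
    (forall k, 0 <= \sum_(i < k) d i) ->
  c n * \sum_(i < n.+1) d i <= \sum_(i < n.+1) c i * d i.
Proof.
move=> + d0; elim: n => [|n IH] cn; first by rewrite !big_ord1.
rewrite big_ord_recr [leRHS]big_ord_recr mulrDr lerD2r.
by apply: le_trans (IH _) => [|i /leqW/cn//]; rewrite ler_wpM2r // cn.
Qed.

(* Karamata's inequality.  The subgradient c is only required at positive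
   points, so that the infinite slope of x^tau at 0 for tau < 1 is harmless: t
   vanishes wherever s does. *)
Lemma majorized_sum_le (f c : R -> R) s t : f 0 = 0 ->
    (forall x y, 0 < x -> 0 <= y -> f x + c x * (y - x) <= f y) ->
    (forall x y, 0 < x -> x <= y -> c x <= c y) ->
    prob_vec s -> prob_vec t -> majorized s t ->
  \sum_(x <- s) f x <= \sum_(x <- t) f x.
Proof.
move=> f0 fc cm ps pt st; have [so s0 s1] := ps; have [_ t0 _] := pt.
have [r rpos rz] := prob_supp ps.
have s1n n : (r <= n)%N -> \sum_(i < n) s`_i = 1.
  by move=> rn; rewrite -s1 (sum_nth (g := id) (n := n)) // =>
    i /(leq_trans rn)/rz.
have t1n n : (r <= n)%N -> \sum_(i < n) t`_i = 1.
  by move=> rn; apply/eqP; rewrite eq_le prob_partial_sum //= -(s1n n rn).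
(* The first r entries of [t] already carry total mass 1, as those of [s] do. *)
have tz i : (r <= i)%N -> t`_i = 0.
  move=> ri; have := t1n _ (leqW ri); rewrite big_ord_recr /= t1n //.
  by rewrite -[RHS]addr0 => /addrI.
rewrite (sum_nth f0 rz) (sum_nth f0 tz).
case: r => [|r] in rpos rz s1n t1n tz *; first by rewrite !big_ord0.
(* Each difference f(t_i) - f(s_i) is at least c(s_i) (t_i - s_i). Abel summation bounds the sum of
   these below by a multiple of the total of t_i - s_i, which is 0. *)
rewrite -subr_ge0 -sumrB.
have /= := @abel_le (fun i => c s`_i) (fun i => t`_i - s`_i) r.
rewrite sumrB s1n // t1n // subrr mulr0 => H; apply: le_trans (H _ _) _.
- move=> i ir; apply: cm; first by apply: rpos; rewrite ltnS.
  exact: nth_sorted_le.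
- by move=> k; rewrite sumrB subr_ge0; exact: st.
apply: ler_sum => i _; rewrite lerBrDl; apply: fc; last exact: nth_ge0.
exact: rpos.
Qed.

(** Young's inequality for the product of z^p and 1, with conjugate exponents 1/p and 1/(1-p). *)
Lemma powR_bernoulli_le z p : 0 <= z -> 0 < p < 1 -> z `^ p <= 1 + p * (z - 1).
Proof.
move=> z0 /andP[p0 p1].
have q0 : 0 < 1 - p by rewrite subr_gt0.
have := @conjugate_powR R (z `^ p) 1 p^-1 (1 - p)^-1.
rewrite !invrK powR_ge0 ler01 !invr_gt0 p0 q0 powR1 mulr1 -powRrM.
rewrite mulfV ?gt_eqF //.
rewrite powRr1 // addrCA subrr addr0 => /(_ isT isT isT isT erefl).
by rewrite (_ : z * p + _ = 1 + p * (z - 1)) //; ring.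
Qed.

(** The previous bound at z^p with exponent 1/p, multiplied by p. *)
Lemma powR_bernoulli_ge z p : 0 <= z -> 1 < p -> 1 + p * (z - 1) <= z `^ p.
Proof.
move=> z0 p1; have p0 : 0 < p by apply: lt_trans p1.
have := @powR_bernoulli_le (z `^ p) p^-1 (powR_ge0 _ _).
rewrite invr_gt0 p0 invf_lt1 // p1 -powRrM mulfV ?gt_eqF // powRr1 // =>
  /(_ isT).
rewrite -(ler_pM2l p0) mulrDr mulr1 mulrA mulfV ?gt_eqF // mul1r; lra.
Qed.

Lemma powR_pred x p : 0 < x -> x `^ p / x = x `^ (p - 1).
Proof. by move=> x0; rewrite powRB ?powRr1 ?ltW // (gt_eqF x0) implybT. Qed.

Lemma powR_tangentE x y p : 0 < x -> 0 <= y ->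
  x `^ p * (1 + p * (y / x - 1)) = x `^ p + p * (x `^ p / x) * (y - x).
Proof. by move=> x0 y0; field; rewrite gt_eqF. Qed.

Lemma powR_scale x y p : 0 < x -> 0 <= y -> y `^ p = x `^ p * (y / x) `^ p.
Proof.
move=> x0 y0.
by rewrite -powRM ?divr_ge0 ?(ltW x0) // mulrCA divff ?mulr1 // gt_eqF.
Qed.

(** Homogeneity moves the tangent point to 1: Bernoulli's inequality at y/x, multiplied by x^p. *)
Lemma powR_tangent_le x y p : 0 < x -> 0 <= y -> 0 < p < 1 ->
  y `^ p <= x `^ p + p * x `^ (p - 1) * (y - x).
Proof.
move=> x0 y0 p01; rewrite -powR_pred // -powR_tangentE // (powR_scale p x0 y0).
by rewrite ler_wpM2l ?powR_ge0 // powR_bernoulli_le ?divr_ge0 // ltW.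
Qed.

Lemma powR_tangent_ge x y p : 0 < x -> 0 <= y -> 1 < p ->
  x `^ p + p * x `^ (p - 1) * (y - x) <= y `^ p.
Proof.
move=> x0 y0 p1; rewrite -powR_pred // -powR_tangentE // (powR_scale p x0 y0).
by rewrite ler_wpM2l ?powR_ge0 // powR_bernoulli_ge ?divr_ge0 // ltW.
Qed.

(** For y > 0 this is ln(1+u) <= u at u = x/y - 1, multiplied by y; at y = 0 it reads -x <= 0. *)
Lemma xlnx_tangent x y : 0 < x -> 0 <= y ->
  x * ln x + (1 + ln x) * (y - x) <= y * ln y.
Proof.
move=> x0; rewrite le_eqVlt => /predU1P[<-|y0]; first by rewrite mul0r; lra.
have /(le_ln1Dx) : -1 < x / y - 1 by rewrite ltrBrDl subrr divr_gt0.
rewrite addrC subrK ln_div // -(ler_pM2l y0) => H.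
have E : y * (x / y - 1) = x - y by field; rewrite gt_eqF.
by move: H; rewrite E; lra.
Qed.

End Majorization.

(** * Additivity, monotonicity and positivity of the Renyi entropies *)

Section Entropy.
Variable R : realType.
Implicit Types (s t u : seq R) (x y z : R) (m : nat) (tau : \bar R).

Lemma tens_pow_ge0 s m : all (>= 0) s -> all (>= 0) (tens_pow s m).
Proof.
move=> /allP s0; elim: m => [|m IH]; first by rewrite /= ler01.
by apply/allP => x /allpairsP[[y z] /= [/s0 ys /(allP IH) zs ->]];
  exact: mulr_ge0.
Qed.

(** Distributivity. The instances used are the identity, the indicator of nonzero entries, and x^p,
    which is multiplicative on nonnegative reals. *)
Lemma sum_tens_pow (g : R -> R) s m : g 1 = 1 ->
    (forall x y, 0 <= x -> 0 <= y -> g (x * y) = g x * g y) ->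
    all (>= 0) s ->
  \sum_(x <- tens_pow s m) g x = (\sum_(x <- s) g x) ^+ m.
Proof.
move=> g1 gM s0; elim: m => [|m IH]; first by rewrite /tens_pow /= big_seq1.
rewrite [tens_pow _ _]iterS big_allpairs_dep exprS -IH mulr_suml.
rewrite big_seq [RHS]big_seq; apply: eq_bigr => x sx.
rewrite mulr_sumr big_seq [RHS]big_seq; apply: eq_bigr => y sy.
by apply: gM; [exact: (allP s0)|exact: (allP (tens_pow_ge0 m s0))].
Qed.

Lemma prob_tens_pow s m : prob_vec s -> prob_vec (sort >=%R (tens_pow s m)).
Proof.
case=> so s0 s1; split; first exact/sort_sorted/ge_total.
  by rewrite all_sort tens_pow_ge0.
rewrite (perm_big _ (permEl (perm_sort _ _))) /=.
by rewrite (sum_tens_pow (g := id)) // s1 expr1n.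
Qed.

(** The power of the largest entry is itself one of the products, and it dominates all of them. *)
Lemma head_tens_pow s m : prob_vec s ->
  (sort >=%R (tens_pow s m))`_0 = s`_0 ^+ m.
Proof.
move=> ps; have [so s0 s1] := ps; have [po p0 _] := prob_tens_pow m ps.
have sN : (0 < size s)%N.
  by rewrite lt0n size_eq0; apply/eqP => s_nil; move: s1 (oner_neq0 R);
    rewrite s_nil big_nil => ->; rewrite eqxx.
have head_mem : s`_0 ^+ m \in tens_pow s m.
  elim: m {po p0} => [|m IH]; first by rewrite inE.
  by rewrite exprS; apply/allpairsP; exists (s`_0, s`_0 ^+ m); rewrite mem_nth.
apply/eqP; rewrite eq_le; apply/andP; split.
  have : (sort >=%R (tens_pow s m))`_0 \in tens_pow s m.
    by rewrite -(mem_sort >=%R) mem_nth // size_sort; case: tens_pow head_mem.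
  move: (_`_0) => x; elim: m x {po p0 head_mem} => [|m IH] x;
    first by rewrite inE => /eqP ->.
  case/allpairsP => -[y z] /= [ys /IH zs ->].
  rewrite exprS; have y0 := allP s0 _ ys.
  apply: (@le_trans _ _ (y * s`_0 ^+ m)); first by rewrite ler_wpM2l.
  rewrite ler_wpM2r ?exprn_ge0 ?nth_ge0 //.
  by have /(nthP 0)[i _ <-] := ys; exact: nth_sorted_le.
have /(nthP 0)[i _ <-] : s`_0 ^+ m \in sort >=%R (tens_pow s m).
  by rewrite mem_sort.
exact: nth_sorted_le.
Qed.

(** Depending on a list only, it applies directly to sorted lists of products. *)
Definition entropy tau s : R :=
  match tau with
  | p%:E =>
      if p == 0 then log2 (count (fun x => x != 0%R) s)%:R
      else if p == 1 then - \sum_(x <- s) x * log2 x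
      else (1 - p)^-1 * log2 (\sum_(x <- s) x `^ p)
  | +oo%E => - log2 s`_0
  | -oo%E => 0
  end.

Lemma renyi_entropyE tau a b (psi : 'M[complex R]_(a, b)) :
  renyi_entropy tau psi = entropy tau (schmidt_vector psi).
Proof. by []. Qed.

Lemma ln2_gt0 : 0 < ln (2 : R).
Proof. by rewrite ln_gt0 // ltr1n. Qed.

Lemma log2X x m : 0 < x -> log2 (x ^+ m) = m%:R * log2 x.
Proof. by move=> x0; rewrite /log2 lnXn // mulr_natl mulrnAl. Qed.

Lemma ler_log2 x y : 0 < x -> x <= y -> log2 x <= log2 y.
Proof.
move=> x0 xy; rewrite /log2 ler_pM2r ?invr_gt0 ?ln2_gt0 // ler_ln ?posrE //.
exact: lt_le_trans xy.
Qed.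

Lemma log2_gt0 x : 1 < x -> 0 < log2 x.
Proof. by move=> x1; rewrite divr_gt0 ?ln2_gt0 ?ln_gt0. Qed.

Lemma log2_lt0 x : 0 < x < 1 -> log2 x < 0.
Proof. by move=> x1; rewrite /log2 pmulr_llt0 ?invr_gt0 ?ln2_gt0 // ln_lt0. Qed.

Lemma sum_nonzero s :
  \sum_(x <- s) (x != 0)%:R = (count (fun x => x != 0) s)%:R :> R.
Proof.
rewrite -sum1_count natr_sum [RHS]big_mkcond.
by apply: eq_bigr => x _; case: (x != 0).
Qed.

Lemma prob_head_gt0 s : prob_vec s -> 0 < s`_0.
Proof.
move=> ps; have [so s0 s1] := ps; rewrite lt_neqAle nth_ge0 // andbT eq_sym.
apply/eqP => h0; have : \sum_(x <- s) x = 0.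
  rewrite (sum_nth (g := id) (n := 0)) ?big_ord0 // => i _.
  by apply/eqP; rewrite eq_le nth_ge0 // andbT -[leRHS]h0 nth_sorted_le.
by rewrite s1 => /eqP; rewrite oner_eq0.
Qed.

Lemma prob_sum_powR_gt0 s p : prob_vec s -> 0 < \sum_(x <- s) x `^ p.
Proof.
move=> ps; have /prob_head_gt0 := ps; case: s ps => [|x s] _ /=;
  first by rewrite ltxx.
move=> x0; rewrite big_cons ltr_pwDl ?powR_gt0 ?sumr_ge0 // => y _;
  exact: powR_ge0.
Qed.

(** Away from order 1 the argument of the logarithm becomes its m-th power; order 1 is an induction
    on log(xy) = log x + log y, using total mass 1. *)
Lemma entropy_tens_pow tau s m : (0 <= tau)%E -> prob_vec s ->
  entropy tau (sort >=%R (tens_pow s m)) = m%:R * entropy tau s.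
Proof.
move=> tau0 ps; have [so s0 s1] := ps.
have S (g : R -> R) : \sum_(x <- sort >=%R (tens_pow s m)) g x =
    \sum_(x <- tens_pow s m) g x by exact/perm_big/permEl/perm_sort.
case: tau tau0 => [p _|_|//] /=; last first.
  by rewrite head_tens_pow // log2X ?mulrN // prob_head_gt0.
case: eqVneq => [_|p0].
  rewrite -!sum_nonzero S (sum_tens_pow (g := fun x =>
    (x != 0)%:R)) ?oner_eq0 //.
    rewrite log2X // sum_nonzero ltr0n -has_count; apply/hasP; exists s`_0.
      apply: mem_nth; rewrite ltnNge; apply/negP => /(nth_default 0) h.
      by have := prob_head_gt0 ps; rewrite h ltxx.
    by rewrite gt_eqF // prob_head_gt0.
  by move=> x y _ _; rewrite mulf_eq0 negb_or -natrM mulnb.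
case: eqVneq => [_|p1].
  rewrite S mulrN; congr (- _).
  elim: m {S} => [|m IH];
    first by rewrite /tens_pow /= big_seq1 /log2 ln1 mul0r mulr0 mul0r.
  rewrite [tens_pow _ _]iterS big_allpairs_dep.
  transitivity (\sum_(x <- s) ((x * log2 x) * (\sum_(y <- tens_pow s m) y) +
      x * (\sum_(y <- tens_pow s m) y * log2 y))).
    rewrite big_seq [RHS]big_seq; apply: eq_bigr => x /(allP s0) x0.
    rewrite !mulr_sumr -big_split big_seq [RHS]big_seq; apply: eq_bigr => y.
    move=> /(allP (tens_pow_ge0 m s0)) y0 /=.
    (* The logarithm splits only at positive arguments; if an entry is 0, both sides vanish. *)
    move: x0 y0; rewrite /= le_eqVlt => /predU1P[<-|x0];
      first by rewrite !(mul0r, addr0).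
    rewrite le_eqVlt => /predU1P[<-|y0];
      first by rewrite !(mul0r, mulr0, addr0).
    by rewrite /log2 lnM //; ring.
  rewrite big_split /= -!mulr_suml s1 (sum_tens_pow (g := id)) // s1 expr1n IH.
  by rewrite mulr1 mul1r -nat1r mulrDl mul1r.
rewrite S (sum_tens_pow (g := fun x => x `^ p)) ?powR1 //;
  last by move=> x y; apply: powRM.
by rewrite log2X ?prob_sum_powR_gt0 // mulrCA.
Qed.

Lemma entropy_majorized tau s t : (0 <= tau)%E -> prob_vec s -> prob_vec t ->
  majorized s t -> entropy tau t <= entropy tau s.
Proof.
move=> tau0 ps pt st; case: tau tau0 => [p|_|//] /=; last first.
  rewrite lerN2; apply: ler_log2; first exact: prob_head_gt0.
  by have := st 1%N; rewrite !big_ord1.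
rewrite lee_fin le_eqVlt => /predU1P[<-|p0]; rewrite ?eqxx ?(gt_eqF p0).
  apply: ler_log2.
    rewrite ltr0n -has_count; apply/hasP; exists t`_0;
      last by rewrite gt_eqF // prob_head_gt0.
    by have /prob_head_gt0 := pt; case: t {pt st} => [|? ?] /=;
      rewrite ?ltxx // inE eqxx.
  rewrite -!sum_nonzero -lerN2 -!sumrN.
  (* At positive points [f] attains its minimum -1, so slope 0 is a subgradient there despite the
     jump at 0. *)
  apply: (majorized_sum_le (f := fun x => - (x != 0)%:R) (c := fun=> 0)) => //=.
    by rewrite eqxx oppr0.
  move=> x y x0 _; rewrite (gt_eqF x0) mul0r addr0 lerN2.
  by case: (y != 0).
case: eqVneq => [_|p1].
  rewrite lerN2 /log2; under eq_bigr do rewrite mulrA;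
    under [leRHS]eq_bigr do rewrite mulrA.
  rewrite -!mulr_suml ler_pM2r ?invr_gt0 ?ln2_gt0 //.
  apply: (majorized_sum_le (f := fun x => x * ln x)
                           (c := fun x => 1 + ln x)) => //=.
  - by rewrite mul0r.
  - by move=> x y; exact: xlnx_tangent.
  - by move=> x y x0 xy; rewrite lerD2l ler_ln ?posrE // (lt_le_trans x0).
have powE x q : x `^ (q - 1) = (x `^ (1 - q))^-1 by rewrite -powRN opprB.
(* The prefactor 1/(1-p) is positive for p < 1, where -x^p is convex, and negative for p > 1, where
   x^p is convex. *)
case: (ltgtP p 1) p1 => // p1 _.
  rewrite ler_pM2l ?invr_gt0 ?subr_gt0 //; apply: ler_log2;
    first exact: prob_sum_powR_gt0.
  rewrite -lerN2 -!sumrN.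
  apply: (majorized_sum_le (f := fun x => - x `^ p)
                           (c := fun x => - (p * x `^ (p - 1)))) => //=.
  - by rewrite powR0 ?oppr0 ?gt_eqF.
  - move=> x y x0 y0; rewrite mulNr -opprD lerN2; apply: powR_tangent_le => //.
    by rewrite p0.
  - move=> x y x0 xy; have y0 := lt_le_trans x0 xy.
    rewrite lerN2 ler_pM2l // !powE // lef_pV2 ?posrE ?powR_gt0 //.
    by apply: ge0_ler_powR; rewrite ?nnegrE ?subr_ge0 // ltW.
rewrite ler_nM2l ?invr_lt0 ?subr_lt0 //; apply: ler_log2;
  first exact: prob_sum_powR_gt0.
apply: (majorized_sum_le (f := fun x => x `^ p)
                         (c := fun x => p * x `^ (p - 1))) => //=.
- by rewrite powR0 ?gt_eqF.
- by move=> x y x0 y0; exact: powR_tangent_ge.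
- move=> x y x0 xy; have y0 := lt_le_trans x0 xy.
  by rewrite ler_pM2l //; apply: ge0_ler_powR; rewrite ?nnegrE ?subr_ge0 // ltW.
Qed.

(** The first two entries sum to at most 1; were the second 0, all later ones would vanish too,
    leaving at most one nonzero entry. *)
Lemma prob_head_lt1 s : prob_vec s ->
  (2 <= count (fun x => x != 0%R) s)%N -> s`_0 < 1.
Proof.
move=> ps; have [so s0 _] := ps; have := prob_partial_sum 2 ps.
rewrite big_ord_recr big_ord1 /= => H c2; apply: lt_le_trans H; rewrite ltrDl.
rewrite lt_neqAle nth_ge0 // andbT eq_sym; apply/eqP => s10.
move: c2; suff -> : count (fun x => x != 0%R) s = (s`_0 != 0%R).
  by case: (_ != _).
have : forall i, s`_i.+1 = 0.
  by move=> i; apply/eqP;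
    rewrite eq_le nth_ge0 // andbT -[leRHS]s10 nth_sorted_le.
case: s {ps so s0 s10} => [|x s] /=; first by rewrite eqxx.
move=> sz; rewrite (@eq_in_count _ _ pred0) ?count_pred0 ?addn0 //.
by move=> y /(nthP 0)[i _ <-]; rewrite sz eqxx.
Qed.

(** The largest entry lies strictly between 0 and 1. For finite orders other than 0, comparing x^p
    with x, or x log x with 0, is therefore strict at the head and weak elsewhere. *)
Lemma entropy_gt0 tau s : (0 <= tau)%E -> prob_vec s ->
  (2 <= count (fun x => x != 0%R) s)%N -> 0 < entropy tau s.
Proof.
move=> tau0 ps c2; have [so s0 s1] := ps.
have h0 := prob_head_gt0 ps; have h1 := prob_head_lt1 ps c2.
have h01 : 0 < s`_0 < 1 by rewrite h0.
have x01 x : x \in s -> 0 <= x <= 1.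
  by case/(nthP 0) => i _ <-; rewrite nth_ge0 // prob_nth_le1.
have sumlt (f g : R -> R) : f s`_0 < g s`_0 ->
    (forall x, 0 < x <= 1 -> f x <= g x) -> f 0 = g 0 ->
    \sum_(x <- s) f x < \sum_(x <- s) g x.
  move=> fg0 fg e0.
  case: s {so s0 s1 c2 h01 ps} fg0 x01 h0 h1 => [|x s] /= fg0 x01 h0 h1;
    first by rewrite ltxx in h0.
  rewrite !big_cons ltr_leD // big_seq [leRHS]big_seq ler_sum // => y ys.
  have /andP[] := x01 y (mem_behead (s := x :: s) ys);
    rewrite le_eqVlt => /predU1P[<- _|y0 y1].
    by rewrite e0.
  by rewrite fg // y0.
case: tau tau0 => [p|_|//] /=; last by rewrite oppr_gt0 log2_lt0.
rewrite lee_fin le_eqVlt => /predU1P[<-|p0]; rewrite ?eqxx ?(gt_eqF p0).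
  by rewrite log2_gt0 // ltr1n.
case: eqVneq => [_|p1].
  have z : \sum_(x <- s) (0 : R) = 0 by rewrite big1.
  rewrite oppr_gt0 -[ltRHS]z.
  apply: (sumlt (fun x => x * log2 x) (fun=> 0)).
  - by rewrite pmulr_rlt0 // log2_lt0.
  - move=> x /andP[x0 x1].
    rewrite pmulr_rle0 // /log2 pmulr_lle0 ?invr_gt0 ?ln2_gt0 //.
    exact: ln_le0.
  - by rewrite mul0r.
have sp0 := prob_sum_powR_gt0 p ps.
case: (ltgtP p 1) p1 => // p1 _.
  rewrite mulr_gt0 ?invr_gt0 ?subr_gt0 // log2_gt0 // -[ltLHS]s1.
  apply: (sumlt id (fun x => x `^ p)).
  - rewrite -{1}[s`_0]powRr1 ?(ltW h0) // /powR gt_eqF // ltr_expR ltr_nM2r //.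
    exact: ln_lt0.
  - by move=> x x01'; apply: ger1_powR => //; exact: ltW.
  - by rewrite powR0 // gt_eqF.
rewrite nmulr_rgt0 ?invr_lt0 ?subr_lt0 // log2_lt0 // sp0 -[ltRHS]s1 /=.
apply: (sumlt (fun x => x `^ p) id).
- rewrite -{2}[s`_0]powRr1 ?(ltW h0) // /powR gt_eqF // ltr_expR ltr_nM2r //.
  exact: ln_lt0.
- by move=> x x01'; apply: ge1r_powR => //; exact: ltW.
- by rewrite powR0 // gt_eqF.
Qed.

End Entropy.

(** * The two bounds on the exchange rate *)

Section ExchangeRate.
Local Open Scope classical_set_scope.
Variable R : realType.

Lemma expr_lt_near (z e : R) : 0 < z < 1 -> 0 < e ->
  exists N, forall n, (N <= n)%N -> z ^+ n < e.
Proof.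
move=> z01 e0; have /andP[z0 _] := z01.
(* Taking logarithms, z^n < e means n > ln e / ln z, because ln z < 0. *)
exists (Num.bound `|ln e / ln z|) => n Nn.
rewrite -ltr_ln ?posrE ?exprn_gt0 // lnXn // -mulr_natl -ltr_ndivrMr ?ln_lt0 //.
apply: le_lt_trans (ler_norm _) _; apply: lt_le_trans (archi_boundP _) _ => //.
by rewrite ler_nat.
Qed.

Lemma majorized_tens_pow (s t : seq R) : prob_vec s -> prob_vec t -> s`_0 < 1 ->
  exists2 m, (0 < m)%N & majorized (sort >=%R (tens_pow s m)) t.
Proof.
move=> ps pt s1; have s0 := prob_head_gt0 ps; have t0 := prob_head_gt0 pt.
have [_ tge0 t1] := pt.
have sz : (0 < size t)%N by case: t t0 {pt tge0 t1} => //=; rewrite ltxx.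
(* With this bound, up to [size t] entries of the power add up to at most t_0. Longer partial sums
   of [t] equal 1. *)
have [N HN] : exists N, forall n, (N <= n)%N -> s`_0 ^+ n < t`_0 / (size t)%:R.
  by apply: expr_lt_near; rewrite ?s0 // divr_gt0 // ltr0n.
exists N.+1 => // l; have pm := prob_tens_pow N.+1 ps.
have [lt|tl] := ltnP l (size t); last first.
  rewrite -[leRHS](sum_nth (g := id)) // => [|i /(leq_trans tl)];
    last exact: nth_default.
  by rewrite t1 prob_partial_sum.
case: l lt => [|l] lt; first by rewrite !big_ord0.
rewrite [leRHS]big_ord_recl; apply: (@le_trans _ _ t`_0); last first.
  by rewrite lerDl sumr_ge0 // => i _; exact: nth_ge0.
have [so ge0 _] := pm.
apply: (@le_trans _ _ (\sum_(i < l.+1) s`_0 ^+ N.+1)).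
  by apply: ler_sum => i _; rewrite -head_tens_pow //; exact: nth_sorted_le.
rewrite sumr_const card_ord -mulr_natl.
apply: (@le_trans _ _ ((size t)%:R * s`_0 ^+ N.+1)).
  by apply: ler_wpM2r; [rewrite exprn_ge0 // ltW|rewrite ler_nat ltnW].
by rewrite mulrC -ler_pdivlMr ?ltr0n // ltW // HN.
Qed.

Variables (a1 b1 a2 b2 : nat).
Variables (psi1 : 'M[complex R]_(a1, b1)) (psi2 : 'M[complex R]_(a2, b2)).
Hypotheses (state1 : pure_state psi1) (state2 : pure_state psi2).
Hypotheses (entangled1 : entangled psi1) (entangled2 : entangled psi2).

Lemma prob_schmidt_vector a b (psi : 'M[complex R]_(a, b)) :
  pure_state psi -> entangled psi -> prob_vec (schmidt_vector psi).
Proof.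
move=> st /schmidt_vectorP ds; split; last exact: schmidt_decomposition_sum ds.
  by case: ds.
by case: ds.
Qed.

Let p1 := prob_schmidt_vector state1 entangled1.
Let p2 := prob_schmidt_vector state2 entangled2.

Lemma locc_powE m n : (0 < m)%N -> (0 < n)%N ->
  locc (ntensmx psi1 m) (ntensmx psi2 n) =
  majorized (sort >=%R (tens_pow (schmidt_vector psi1) m))
            (sort >=%R (tens_pow (schmidt_vector psi2) n)).
Proof. by move=> m0 n0; rewrite /locc !schmidt_vector_pow. Qed.

(** The maximum must exist, or the default 0 is returned. Comparing largest coefficients, s_0^m <=
    t_0^k with t_0 < 1, bounds every feasible k. *)
Lemma max_copies_gt0 m n : (0 < m)%N -> (0 < n)%N ->
  locc (ntensmx psi1 m) (ntensmx psi2 n) -> (0 < max_copies psi1 psi2 m)%N.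
Proof.
move=> m0 n0 mn.
have h2 : 0 < (schmidt_vector psi2)`_0 < 1.
  by rewrite prob_head_gt0 // prob_head_lt1.
have [N HN] := expr_lt_near h2 (exprn_gt0 m (prob_head_gt0 p1)).
pose P k := `[< (0 < k)%N /\ locc (ntensmx psi1 m) (ntensmx psi2 k) >].
have exP : exists k, P k by exists n; apply/asboolP.
have bP k : P k -> (k <= N)%N.
  move=> /asboolP[k0]; rewrite locc_powE // => /(_ 1%N).
  rewrite !big_ord1 !head_tens_pow // => H; rewrite leqNgt; apply/negP => /ltnW.
  by move=> /HN; rewrite ltNge H.
rewrite /max_copies; case: xgetP => [x -> [] //|].
case: (ex_maxnP exP bP) => k /asboolP[k0 mk] kmax /(_ k) [].
by split=> // j j0 mj; apply: kmax; apply/asboolP.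
Qed.

Lemma max_copies_locc m : (0 < max_copies psi1 psi2 m)%N ->
  locc (ntensmx psi1 m) (ntensmx psi2 (max_copies psi1 psi2 m)).
Proof. by rewrite /max_copies; case: xgetP => // x -> []. Qed.

Lemma exchange_rate_gt0 : (0 < exchange_rate psi1 psi2)%E.
Proof.
have [m m0 mP] := majorized_tens_pow p1 p2 (prob_head_lt1 p1 entangled1).
apply: (@lt_le_trans _ _ ((max_copies psi1 psi2 m)%:R / m%:R)%:E); last first.
  by apply: ereal_sup_ubound; exists m.
(* With n = 1 the target is a single copy of [psi2], which [mP] provides. *)
rewrite lte_fin divr_gt0 ?ltr0n // (@max_copies_gt0 m 1) //.
by rewrite /locc schmidt_vector_pow.
Qed.

Lemma exchange_rate_le : (exchange_rate psi1 psi2 <= entropy_ratio psi1 psi2)%E.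
Proof.
apply: ge_ereal_sup => _ [m m0 <-]; apply: le_ereal_inf_tmp => _ [tau tau0 <-].
rewrite lee_fin !renyi_entropyE.
have e1 := entropy_gt0 tau0 p1 entangled1.
have e2 := entropy_gt0 tau0 p2 entangled2.
(* A value 0 may be the default and gives no conversion, but then the left side is 0. *)
have [->|n0] := posnP (max_copies psi1 psi2 m).
  by rewrite mul0r divr_ge0 // ltW.
have := max_copies_locc n0; move: (max_copies _ _ m) n0 => n n0.
rewrite locc_powE // =>
  /(entropy_majorized tau0 (prob_tens_pow m p1) (prob_tens_pow n p2)).
rewrite !entropy_tens_pow // => H.
by rewrite ler_pdivrMr ?ltr0n // mulrAC ler_pdivlMr // [leRHS]mulrC.
Qed.

End ExchangeRate.

Theorem theorem1 (R : realType) (a1 b1 a2 b2 : nat)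
    (psi1 : 'M[complex R]_(a1, b1)) (psi2 : 'M[complex R]_(a2, b2))
    (state1 : pure_state psi1) (state2 : pure_state psi2)
    (entangled1 : entangled psi1) (entangled2 : entangled psi2) :
  (0 < exchange_rate psi1 psi2)%E /\
  (exchange_rate psi1 psi2 <= entropy_ratio psi1 psi2)%E.
Proof.
split; first exact: exchange_rate_gt0.
exact: exchange_rate_le.
Qed.
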